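(* Let $m,n\in\mathbb{N}$, let $\mathbf{A}\in\mathbb{IR}^{m\times n}$ be an interval matrix, $\mathbf{b}\in\mathbb{IR}^m$ an interval vector, $\mathcal{A}\in\{\forall,\exists\}^{m\times n}$ a quantifier matrix, $\beta\in\{\forall,\exists\}^m$ a quantifier vector, and $\sigma\in\{=,\ge,\le\}^m$ a vector of relations. Let $Q^{\sigma}(\mathbf{A},\mathbf{b},\mathcal{A},\beta)$ be any quantifier prefix such that, for each $i$ for which $\sigma_i$ is ``$=$'', among the elementary prefixes related to the $i$-th row the universal quantifiers (if any) precede the existential quantifiers (if any). Define $u,v\in\overline{\mathbb{R}}^m$ by $$u_i=\begin{cases}0,&\text{if }\sigma_i\text{ is ``}=\text{'' or ``}\ge\text{''},\\-\infty,&\text{if }\sigma_i\text{ is ``}\le\text{''},\end{cases}\qquad v_i=\begin{cases}0,&\text{if }\sigma_i\text{ is ``}=\text{'' or ``}\le\text{''},\\ \infty,&\text{if }\sigma_i\text{ is ``}\ge\text{''}.\end{cases}$$ Then for every $x\in\mathbb{R}^n$, $$Q^{\sigma}(\mathbf{A},\mathbf{b},\mathcal{A},\beta)\ (Ax\,\sigma\,b)\ \Longleftrightarrow\ \begin{cases}\underline{\mathbf{A}^{\mathfrak{c}}x}\ge\underline{\mathbf{b}^{\mathfrak{c}}}+u,\\ \overline{\mathbf{A}^{\mathfrak{c}}x}\le\overline{\mathbf{b}^{\mathfrak{c}}}+v\end{cases}\ \Longleftrightarrow\ \begin{cases}\underline{\mathbf{A}^{\forall}x}+\overline{\mathbf{A}^{\exists}x}\ge\overline{\mathbf{b}^{\forall}}+\underline{\mathbf{b}^{\exists}}+u,\\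 \overline{\mathbf{A}^{\forall}x}+\underline{\mathbf{A}^{\exists}x}\le\underline{\mathbf{b}^{\forall}}+\overline{\mathbf{b}^{\exists}}+v,\end{cases}$$ where each brace denotes the conjunction of the two componentwise inequalities in $\overline{\mathbb{R}}^m$.
   Context: $\overline{\mathbb{R}}=\mathbb{R}\cup\{-\infty,\infty\}$ is the extended real axis. Intervals. $\mathbb{KR}$ (Kaucher intervals) is the set of all pairs $\mathbf{u}=[\underline{\mathbf{u}},\overline{\mathbf{u}}]$ with $\underline{\mathbf{u}},\overline{\mathbf{u}}\in\mathbb{R}$ (no order required between the endpoints); $\mathbb{IR}\subset\mathbb{KR}$ consists of those with $\underline{\mathbf{u}}\le\overline{\mathbf{u}}$, identified with the sets $\{u\in\mathbb{R}:\underline{\mathbf{u}}\le u\le\overline{\mathbf{u}}\}$. A real $\lambda$ is identified with $[\lambda,\lambda]$. $\operatorname{dual}\mathbf{u}=[\overline{\mathbf{u}},\underline{\mathbf{u}}]$. Addition: $\mathbf{u}+\mathbf{v}=[\underline{\mathbf{u}}+\underline{\mathbf{v}},\overline{\mathbf{u}}+\overline{\mathbf{v}}]$; multiplication by a real: $\lambda\mathbf{u}=[\lambda\underline{\mathbf{u}},\lambda\overline{\mathbf{u}}]$ for $\lambda\ge0$ and $\lambda\mathbf{u}=[\lambda\overline{\mathbf{u}},\lambda\underline{\mathbf{u}}]$ for $\lambda\le0$. For an interval matrix $\mathbf{M}$ and $x\in\mathbb{R}^n$, $(\mathbf{M}x)_i=\sum_j x_j\mathbf{M}_{ij}$. For vectors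 and matrices, endpoints (underline for lower/left, overline for upper/right), inequalities, addition and $\operatorname{dual}$ are componentwise. Quantifier prefixes. With each parameter $A_{ij}$ associate the elementary prefix $(\mathcal{A}_{ij}\,A_{ij}\in\mathbf{A}_{ij})$, and with each parameter $b_i$ the elementary prefix $(\beta_i\,b_i\in\mathbf{b}_i)$. $Q(\mathbf{A},\mathbf{b},\mathcal{A},\beta)$ denotes a prefix of length $m(n+1)$ containing each of these elementary prefixes exactly once, in an arbitrary order; superscripts on $Q$ indicate additional conditions on this order. The elementary prefixes related to the $i$-th row are those of $A_{i1},\dots,A_{in},b_i$. The predicate $Q(\mathbf{A},\mathbf{b},\mathcal{A},\beta)\,(Ax\,\sigma\,b)$ has free variable $x\in\mathbb{R}^n$, and $Ax\,\sigma\,b$ is the conjunction over $i$ of $\bigl(\sum_j A_{ij}x_j\bigr)\,\sigma_i\,b_i$. Derived matrices and vectors: $\mathbf{A}^{\forall}_{ij}=\mathbf{A}_{ij}$ if $\mathcal{A}_{ij}=\forall$ and $0$ if $\mathcal{A}_{ij}=\exists$; $\mathbf{A}^{\exists}_{ij}=\mathbf{A}_{ij}$ if $\mathcal{A}_{ij}=\exists$ and $0$ if $\mathcal{A}_{ij}=\forall$; $\mathbf{b}^{\forall}_i=\mathbf{b}_i$ if $\beta_i=\forall$ and $0$ if $\beta_i=\exists$; $\mathbf{b}^{\exists}_i=\mathbf{b}_i$ if $\beta_i=\exists$ and $0$ if $\beta_i=\forall$; $\mathbf{A}^{\mathfrak{c}}_{ij}=\mathbf{A}_{ij}$ if $\mathcal{A}_{ij}=\forall$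 and $\operatorname{dual}\mathbf{A}_{ij}$ if $\mathcal{A}_{ij}=\exists$; $\mathbf{b}^{\mathfrak{c}}_i=\operatorname{dual}\mathbf{b}_i$ if $\beta_i=\forall$ and $\mathbf{b}_i$ if $\beta_i=\exists$. *)

(* Defs.v *)
From HB Require Import structures.
From mathcomp Require Import all_boot all_order all_algebra.
From mathcomp Require Import reals constructive_ereal.

Set Implicit Arguments.
Unset Strict Implicit.
Unset Printing Implicit Defensive.

Import Order.TTheory GRing.Theory Num.Theory.

Local Open Scope ring_scope.

(* The endpoints are not required to be ordered. *)
Record kaucher (R : realType) := Kaucher { lower : R; upper : R }.

Definition kreal (R : realType) (a : R) : kaucher R := Kaucher a a.

Definition kadd (R : realType) (u v : kaucher R) : kaucher R :=
  Kaucher (lower u + lower v) (upper u + upper v).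

Fact kaddA (R : realType) : associative (@kadd R).
Proof. by move=> u v w; rewrite /kadd /= !addrA. Qed.
Fact kaddC (R : realType) : commutative (@kadd R).
Proof. by move=> u v; rewrite /kadd [lower u + _]addrC [upper u + _]addrC. Qed.
Fact kadd0 (R : realType) : left_id (kreal 0) (@kadd R).
Proof. by case=> a b; rewrite /kadd /= !add0r. Qed.
HB.instance Definition _ (R : realType) :=
  Monoid.isComLaw.Build (kaucher R) (kreal 0) (@kadd R)
    (@kaddA R) (@kaddC R) (@kadd0 R).

Definition proper (R : realType) (u : kaucher R) : Prop := lower u <= upper u.

Definition contains (R : realType) (u : kaucher R) (t : R) : Prop :=
  lower u <= t <= upper u.

Definition kdual (R : realType) (u : kaucher R) : kaucher R :=
  Kaucher (upper u) (lower u).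

Definition kscale (R : realType) (a : R) (u : kaucher R) : kaucher R :=
  if 0 <= a then Kaucher (a * lower u) (a * upper u)
  else Kaucher (a * upper u) (a * lower u).

Definition kmulmx (R : realType) (m n : nat)
    (M : 'M[kaucher R]_(m, n)) (x : 'cV[R]_n) : 'cV[kaucher R]_m :=
  \col_i \big[@kadd R/kreal 0]_j kscale (x j 0) (M i j).

Definition lower_mx (R : realType) (m n : nat) (M : 'M[kaucher R]_(m, n)) :
  'M[R]_(m, n) := map_mx (@lower R) M.
Definition upper_mx (R : realType) (m n : nat) (M : 'M[kaucher R]_(m, n)) :
  'M[R]_(m, n) := map_mx (@upper R) M.

Definition proper_mx (R : realType) (m n : nat) (M : 'M[kaucher R]_(m, n)) :
  Prop := forall i j, proper (M i j).

Inductive quantifier := QForall | QExists.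

Inductive relation := RelEq | RelGe | RelLe.

Definition rel_holds (R : realType) (s : relation) (a b : R) : Prop :=
  match s with
  | RelEq => a = b
  | RelGe => a >= b
  | RelLe => a <= b
  end.

(* [inl (i, j)] stands for the parameter A_ij and [inr i] for b_i. *)
Definition param (m n : nat) : finType := ('I_m * 'I_n + 'I_m)%type.

Definition param_row (m n : nat) (p : param m n) : 'I_m :=
  match p with inl ij => ij.1 | inr i => i end.

Definition param_quant (m n : nat) (QA : 'M[quantifier]_(m, n))
    (Qb : 'cV[quantifier]_m) (p : param m n) : quantifier :=
  match p with inl ij => QA ij.1 ij.2 | inr i => Qb i 0 end.

Definition param_itv (R : realType) (m n : nat) (A : 'M[kaucher R]_(m, n))
    (b : 'cV[kaucher R]_m) (p : param m n) : kaucher R :=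
  match p with inl ij => A ij.1 ij.2 | inr i => b i 0 end.

(* The quantifier and the interval of each elementary prefix are determined by
   its parameter, so a quantifier prefix is an ordering of the parameters,
   outermost first. *)
Definition is_prefix (m n : nat) (Q : seq (param m n)) : Prop :=
  perm_eq Q (enum (param m n)).

Definition forall_before_exists_on_eq_rows (m n : nat)
    (QA : 'M[quantifier]_(m, n)) (Qb : 'cV[quantifier]_m)
    (sigma : 'cV[relation]_m) (Q : seq (param m n)) : Prop :=
  forall (i : 'I_m) (p q : param m n),
    sigma i 0 = RelEq -> param_row p = i -> param_row q = i ->
    param_quant QA Qb p = QForall -> param_quant QA Qb q = QExists ->
    (index p Q < index q Q)%N.

Definition update (R : realType) (m n : nat) (v : param m n -> R)
    (p : param m n) (t : R) : param m n -> R :=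
  fun q => if q == p then t else v q.

Fixpoint quantify (R : realType) (m n : nat)
    (A : 'M[kaucher R]_(m, n)) (b : 'cV[kaucher R]_m)
    (QA : 'M[quantifier]_(m, n)) (Qb : 'cV[quantifier]_m)
    (Q : seq (param m n)) (P : (param m n -> R) -> Prop)
    (v : param m n -> R) : Prop :=
  match Q with
  | [::] => P v
  | p :: Q' =>
    match param_quant QA Qb p with
    | QForall => forall t, contains (param_itv A b p) t ->
        quantify A b QA Qb Q' P (update v p t)
    | QExists => exists t, contains (param_itv A b p) t /\
        quantify A b QA Qb Q' P (update v p t)
    end
  end.

Definition system_holds (R : realType) (m n : nat) (sigma : 'cV[relation]_m)
    (A : 'M[R]_(m, n)) (b : 'cV[R]_m) (x : 'cV[R]_n) : Prop :=
  forall i, rel_holds (sigma i 0) ((A *m x) i 0) (b i 0).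

(* The initial valuation is irrelevant when [Q] binds every parameter. *)
Definition quantified_system (R : realType) (m n : nat)
    (A : 'M[kaucher R]_(m, n)) (b : 'cV[kaucher R]_m)
    (QA : 'M[quantifier]_(m, n)) (Qb : 'cV[quantifier]_m)
    (sigma : 'cV[relation]_m) (Q : seq (param m n)) (x : 'cV[R]_n) : Prop :=
  quantify A b QA Qb Q
    (fun v => system_holds sigma (\matrix_(i, j) v (inl (i, j)))
                (\col_i v (inr i)) x)
    (fun=> 0).

Definition forall_part (R : realType) (m n : nat) (M : 'M[kaucher R]_(m, n))
    (Q : 'M[quantifier]_(m, n)) : 'M[kaucher R]_(m, n) :=
  \matrix_(i, j) match Q i j with QForall => M i j | QExists => kreal 0 end.

Definition exists_part (R : realType) (m n : nat) (M : 'M[kaucher R]_(m, n))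
    (Q : 'M[quantifier]_(m, n)) : 'M[kaucher R]_(m, n) :=
  \matrix_(i, j) match Q i j with QForall => kreal 0 | QExists => M i j end.

(* The coefficient matrix is dualized at its existential entries, the
   right-hand side at its universal ones. *)
Definition charact_mx (R : realType) (m n : nat) (A : 'M[kaucher R]_(m, n))
    (QA : 'M[quantifier]_(m, n)) : 'M[kaucher R]_(m, n) :=
  \matrix_(i, j)
    match QA i j with QForall => A i j | QExists => kdual (A i j) end.

Definition charact_rhs (R : realType) (m : nat) (b : 'cV[kaucher R]_m)
    (Qb : 'cV[quantifier]_m) : 'cV[kaucher R]_m :=
  \col_i match Qb i 0 with QForall => kdual (b i 0) | QExists => b i 0 end.

Definition slack_lower (R : realType) (m : nat) (sigma : 'cV[relation]_m) :
    'cV[\bar R]_m :=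
  \col_i match sigma i 0 with
         | RelEq | RelGe => 0%E
         | RelLe => -oo%E
         end.

Definition slack_upper (R : realType) (m : nat) (sigma : 'cV[relation]_m) :
    'cV[\bar R]_m :=
  \col_i match sigma i 0 with
         | RelEq | RelLe => 0%E
         | RelGe => +oo%E
         end.

Definition ext_col (R : realType) (m : nat) (a : 'cV[R]_m) : 'cV[\bar R]_m :=
  map_mx EFin a.

Definition le_col (R : realType) (m : nat) (a b : 'cV[\bar R]_m) : Prop :=
  forall i, (a i 0%R <= b i 0%R)%E.

(* Main.v *)
Require Import Defs.
From HB Require Import structures.
From mathcomp Require Import all_boot all_order all_algebra.
From mathcomp Require Import reals constructive_ereal.
From mathcomp Require Import lra.

(** Move every right-hand side to the left: row [i] then asks that the sum of
    the terms [w p * v p] over the parameters [p] of the row be zero, nonnegative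
    or nonpositive, where [w p] is an entry of [x] for a coefficient and [-1] for
    a right-hand side. Parameters of different rows share nothing, so the prefix
    can be eliminated from the outside in while each row keeps one Kaucher
    interval: the sum of [w p * v p] over the parameters already chosen plus the
    sum of the scaled intervals of the parameters still bound, dualized at the
    existential ones ([row_enclosure]). The condition on a row is that the lower
    endpoint of this interval be nonnegative, the upper endpoint nonpositive, or
    both ([admissible]); [quantify_admissible] says that it is equivalent to the
    quantified system at every stage of the elimination.

    A universal parameter contributes its worst value to each endpoint
    ([admissible_forall]). An existential one contributes its best value, and for
    an inequality that value can simply be chosen. For an equality one choice
    must serve both endpoints; this is possible when the rest of the row is an
    improper interval, because two nonempty intervals of the line meet as soon as
    neither lies entirely to one side of the other ([admissible_exists]). The
    condition on the order of the prefix provides exactly this: once an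
    existential parameter of an equality row is reached, only existential
    parameters of that row remain, and their dualized intervals are improper
    ([row_rest_improper]).

    With the whole prefix bound, the row interval has the endpoints of
    [charact_mx A QA] times [x] minus those of [charact_rhs b Qb], which gives the
    first equivalence. In the second one both systems have equal sides, since
    dualizing an entry exchanges its endpoints. *)

Import Order.TTheory GRing.Theory Num.Theory.

Local Open Scope ring_scope.

(** * Kaucher intervals *)

Section KaucherTheory.

Context {R : realType}.
Implicit Types (I J C : kaucher R) (s t w : R).

Lemma lower_kadd I J : lower (kadd I J) = lower I + lower J.
Proof. by []. Qed.

Lemma upper_kadd I J : upper (kadd I J) = upper I + upper J.
Proof. by []. Qed.

Lemma lower_ksum (T : finType) (P : pred T) (F : T -> kaucher R) :
  lower (\big[@kadd R/kreal 0]_(p | P p) F p) = \sum_(p | P p) lower (F p).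
Proof. exact: (big_morph _ lower_kadd). Qed.

Lemma upper_ksum (T : finType) (P : pred T) (F : T -> kaucher R) :
  upper (\big[@kadd R/kreal 0]_(p | P p) F p) = \sum_(p | P p) upper (F p).
Proof. exact: (big_morph _ upper_kadd). Qed.

Lemma kscale_dual w I : kscale w (kdual I) = kdual (kscale w I).
Proof. by rewrite /kscale; case: ifP. Qed.

Lemma kscale0 w : kscale w (kreal 0) = kreal 0.
Proof. by rewrite /kscale /= mulr0; case: ifP. Qed.

Lemma proper_kscale w I : Defs.proper I -> Defs.proper (kscale w I).
Proof.
rewrite /Defs.proper /kscale; have [w0|w0] := leP 0 w => /= hI.
  exact: ler_wpM2l.
by apply: ler_wnM2l => //; apply: ltW.
Qed.

(** Scaling by a real is the image of the set: this is what turns a quantifier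
    over a parameter into one over its contribution to the row. *)
Lemma contains_kscale w I s : Defs.proper I ->
  contains (kscale w I) s <-> exists t, contains I t /\ s = w * t.
Proof.
rewrite /Defs.proper /contains /kscale => hI; split; last first.
  case=> t [/andP[lt tu] ->]; have [w0|w0] := leP 0 w => /=.
    by rewrite !ler_wpM2l.
  by rewrite !ler_wnM2l // ltW.
have [w0|w0|w0] := ltgtP 0 w => /= /andP[ls su].
- exists (s / w); split; last by rewrite mulrCA divff ?mulr1 // gt_eqF.
  by rewrite ler_pdivlMr // ler_pdivrMr // ![_ * w]mulrC ls su.
- exists (s / w); split; last by rewrite mulrCA divff ?mulr1 // lt_eqF.
  by rewrite ler_ndivlMr // ler_ndivrMr // ![_ * w]mulrC ls su.
- exists (lower I); split; first by rewrite lexx.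
  by move: ls su; rewrite -w0 !mul0r => ls su; apply/eqP; rewrite eq_le su ls.
Qed.

Definition admissible (r : relation) I : Prop :=
  match r with
  | RelEq => 0 <= lower I /\ upper I <= 0
  | RelGe => 0 <= lower I
  | RelLe => upper I <= 0
  end.

Lemma admissible_kreal r s : admissible r (kreal s) <-> rel_holds r s 0.
Proof.
case: r => //=; split=> [[s0 s1]|->]; last by rewrite lexx.
by apply/eqP; rewrite eq_le s1.
Qed.

Lemma admissible_forall r C J : Defs.proper J ->
  (forall s, contains J s -> admissible r (kadd C (kreal s))) <->
  admissible r (kadd C J).
Proof.
rewrite /Defs.proper /contains => hJ; split=> [H|H s /andP[ls su]].
  have /H Hl : lower J <= lower J <= upper J by rewrite lexx.
  have /H Hu : lower J <= upper J <= upper J by rewrite lexx andbT.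
  by case: r H Hl Hu => //= _ [Hl _] [_ Hu].
by case: r H => //=; lra.
Qed.

Lemma admissible_exists r C J : Defs.proper J ->
  (r = RelEq -> Defs.proper (kdual C)) ->
  (exists s, contains J s /\ admissible r (kadd C (kreal s))) <->
  admissible r (kadd C (kdual J)).
Proof.
rewrite /Defs.proper /contains => hJ hC; split=> [[s [/andP[ls su]]]|].
  by case: r {hC} => //=; lra.
case: r hC => /= hC H.
- (* The leftmost point common to [J] and to the interval of admissible choices
     with endpoints [- lower C] and [- upper C]. *)
  exists (Num.max (lower J) (- lower C)).
  have {}hC := hC erefl; case: H => H1 H2.
  by case: (leP (lower J) (- lower C)) => ?; split; try (apply/andP; split); lra.
- by exists (upper J); rewrite lexx hJ.
- by exists (lower J); rewrite lexx hJ.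
Qed.

End KaucherTheory.

(** * Elimination of the prefix *)

Section Elimination.

Context {R : realType} {m n : nat}.
Context (A : 'M[kaucher R]_(m, n)) (b : 'cV[kaucher R]_m).
Context (QA : 'M[quantifier]_(m, n)) (Qb : 'cV[quantifier]_m).
Context (sigma : 'cV[relation]_m) (x : 'cV[R]_n).
Implicit Types (p q : param m n) (Q : seq (param m n)) (v : param m n -> R).
Implicit Types (i : 'I_m).

Definition weight p : R := match p with inl ij => x ij.2 0 | inr _ => -1 end.

(** Right-hand sides enter with weight [-1], so here they are dualized at their
    existential entries, like the coefficients and contrary to
    [charact_rhs b Qb]. *)
Definition charact_itv p : kaucher R :=
  match param_quant QA Qb p with
  | QForall => param_itv A b p
  | QExists => kdual (param_itv A b p)
  end.

Definition contribution v Q p : kaucher R :=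
  if p \in Q then kscale (weight p) (charact_itv p)
  else kreal (weight p * v p).

Definition row_enclosure v Q i : kaucher R :=
  \big[@kadd R/kreal 0]_(p | param_row p == i) contribution v Q p.

Definition row_rest v Q p : kaucher R :=
  \big[@kadd R/kreal 0]_(q | (param_row q == param_row p) && (q != p))
    contribution v Q q.

Lemma sum_param_row (T : Type) (idx : T) (op : Monoid.com_law idx)
    (F : param m n -> T) i :
  \big[op/idx]_(p | param_row p == i) F p =
  op (\big[op/idx]_j F (inl (i, j))) (F (inr i)).
Proof.
rewrite big_sumType /= big_pred1_eq; congr (op _ _).
have := pair_big_dep (fun k : 'I_m => k == i) (fun _ _ => true)
  (fun k j => F (inl (k, j))) (op := op).
rewrite big_pred1_eq => ->; apply: eq_big => [[k j]|[k j] _] //=.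
by rewrite andbT.
Qed.

Lemma row_enclosure_head v Q p : p \notin Q ->
  row_enclosure v (p :: Q) (param_row p) =
  kadd (row_rest v Q p) (kscale (weight p) (charact_itv p)).
Proof.
move=> pQ; rewrite /row_enclosure (bigD1 p) //= kaddC; congr kadd; last first.
  by rewrite /contribution mem_head.
apply: eq_bigr => q /andP[_ qp].
by rewrite /contribution inE (negbTE qp).
Qed.

Lemma row_enclosure_update v Q p t : p \notin Q ->
  row_enclosure (update v p t) Q (param_row p) =
  kadd (row_rest v Q p) (kreal (weight p * t)).
Proof.
move=> pQ; rewrite /row_enclosure (bigD1 p) //= kaddC; congr kadd; last first.
  by rewrite /contribution (negbTE pQ) /update eqxx.
by apply: eq_bigr => q /andP[_ qp]; rewrite /contribution /update (negbTE qp).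
Qed.

Lemma row_enclosure_other v Q p t i : i != param_row p ->
  row_enclosure (update v p t) Q i = row_enclosure v (p :: Q) i.
Proof.
move=> ip; apply: eq_bigr => q /eqP qi.
have qp : q != p by apply: contraNneq ip => <-; rewrite qi.
by rewrite /contribution /update inE (negbTE qp).
Qed.

Lemma forall_row_split (P : 'I_m -> Prop) p :
  (forall i, P i) <-> P (param_row p) /\ forall i, i != param_row p -> P i.
Proof.
split=> [H|[Hp H] i]; first by split=> // i _.
by have [->|/H] := eqVneq i (param_row p).
Qed.

Lemma admissible_update v Q p t : p \notin Q ->
  (forall i, admissible (sigma i 0) (row_enclosure (update v p t) Q i)) <->
  admissible (sigma (param_row p) 0)
    (kadd (row_rest v Q p) (kreal (weight p * t))) /\
  forall i, i != param_row p ->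
    admissible (sigma i 0) (row_enclosure v (p :: Q) i).
Proof.
move=> pQ; rewrite (forall_row_split _ p) row_enclosure_update //.
by split=> -[Hp H]; split=> // i ip; move: (H i ip);
  rewrite row_enclosure_other.
Qed.

(** The restriction to members of [Q] is what makes the order condition pass to
    the tails of a prefix. *)
Definition ordered_on_eq_rows Q : Prop :=
  forall p q, p \in Q -> q \in Q ->
    param_row p = param_row q -> sigma (param_row p) 0 = RelEq ->
    param_quant QA Qb p = QForall -> param_quant QA Qb q = QExists ->
    (index p Q < index q Q)%N.

Lemma ordered_on_eq_rows_behead p Q : p \notin Q ->
  ordered_on_eq_rows (p :: Q) -> ordered_on_eq_rows Q.
Proof.
move=> pQ H q r qQ rQ e s fq er.
have neq z : z \in Q -> (p == z) = false.
  by move=> zQ; apply: contraNF pQ => /eqP ->.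
have := H q r; rewrite !inE qQ rQ !orbT /= !neq // ltnS; exact.
Qed.

Lemma param_itv_proper p : proper_mx A -> proper_mx b ->
  Defs.proper (param_itv A b p).
Proof. by move=> hA hb; case: p => [[i j]|i]; [exact: hA|exact: hb]. Qed.

(** The only use of the order of the prefix. *)
Lemma row_rest_improper v Q p : proper_mx A -> proper_mx b ->
  ordered_on_eq_rows (p :: Q) -> param_quant QA Qb p = QExists ->
  sigma (param_row p) 0 = RelEq -> Defs.proper (kdual (row_rest v Q p)).
Proof.
move=> hA hb hQ ep sp; rewrite /Defs.proper /= lower_ksum upper_ksum.
apply: ler_sum => q /andP[/eqP qp nqp]; rewrite /contribution.
case: ifP => // qQ; rewrite /charact_itv; case fq: (param_quant QA Qb q).
  (* A universal [q] would have to come before the head of the list. *)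
  have := hQ q p; rewrite !inE qQ eqxx orbT /= eqxx qp ltn0.
  by move=> /(_ isT isT erefl sp fq ep).
by rewrite kscale_dual; apply/proper_kscale/param_itv_proper.
Qed.

Lemma row_enclosure_nil v i :
  row_enclosure v [::] i =
  kreal (((\matrix_(i, j) v (inl (i, j))) *m x) i 0
         - (\col_i v (inr i) : 'cV[R]_m) i 0).
Proof.
rewrite /row_enclosure (eq_bigr (fun p => kreal (weight p * v p))) //.
have krealD : {morph @kreal R : s t / s + t >-> kadd s t} by [].
rewrite -(big_morph _ krealD (erefl (kreal 0))).
rewrite sum_param_row /= !mxE mulN1r; congr (kreal (_ - _)).
by apply: eq_bigr => j _; rewrite mxE mulrC.
Qed.

(** Induction from the outermost quantifier: binding [p] changes the interval of
    its own row only, so the quantifier over [p] commutes with the conditions on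
    the other rows. For a universal [p] this uses that its interval is
    nonempty. *)
Lemma quantify_admissible Q v : proper_mx A -> proper_mx b ->
  uniq Q -> ordered_on_eq_rows Q ->
  quantify A b QA Qb Q
    (fun v => system_holds sigma (\matrix_(i, j) v (inl (i, j)))
                (\col_i v (inr i)) x) v <->
  forall i, admissible (sigma i 0) (row_enclosure v Q i).
Proof.
move=> hA hb; elim: Q v => [|p Q IH] v.
  move=> _ _; split=> H i; have := H i; rewrite row_enclosure_nil;
    rewrite admissible_kreal; case: (sigma i 0) => /=; lra.
move=> /andP[pQ uQ] oQ.
have {IH} IH t : quantify A b QA Qb Q _ (update v p t) <-> _ :=
  iff_trans (IH (update v p t) uQ (ordered_on_eq_rows_behead p Q pQ oQ))
            (admissible_update v Q p t pQ).
have hp := param_itv_proper p hA hb.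
have hJ := proper_kscale (weight p) _ hp.
rewrite (forall_row_split _ p) row_enclosure_head // /charact_itv /=.
case ep: (param_quant QA Qb p).
  rewrite -admissible_forall //; split=> [H|[H Hother] t tI].
    split=> [s /contains_kscale -/(_ hp)[t [/H/IH[Ht _] ->]] //|].
    have /H/IH[_ //] : contains (param_itv A b p) (lower (param_itv A b p)).
    by rewrite /contains lexx.
  by apply/IH; split=> //; apply/H/contains_kscale => //; exists t.
rewrite kscale_dual -admissible_exists //; last exact: row_rest_improper.
split=> [[t [tI /IH[Ht Hother]]]|].
  split=> //; exists (weight p * t); split=> //.
  by apply/contains_kscale => //; exists t.
move=> [[s [/contains_kscale -/(_ hp)[t [tI ->]] Ht]] Hother].
by exists t; split=> //; apply/IH.
Qed.

Lemma row_enclosure_full v Q i : (forall p, p \in Q) ->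
  row_enclosure v Q i =
  Kaucher (lower_mx (kmulmx (charact_mx A QA) x) i 0
             - lower_mx (charact_rhs b Qb) i 0)
          (upper_mx (kmulmx (charact_mx A QA) x) i 0
             - upper_mx (charact_rhs b Qb) i 0).
Proof.
move=> allQ; rewrite /row_enclosure sum_param_row !mxE /contribution allQ.
rewrite (eq_bigr (fun j => kscale (x j 0) (charact_mx A QA i j))).
  rewrite /= /kadd /kscale /charact_itv /= ler0N1.
  by case: (Qb i 0); rewrite /= !mulN1r.
by move=> j _; rewrite mxE allQ.
Qed.

End Elimination.

(** * The inequality systems *)

Lemma charact_inequalities_admissible (R : realType) (m : nat)
    (sigma : 'cV[relation]_m) (lb ub l u : 'cV[R]_m) :
  le_col (ext_col lb + slack_lower R sigma) (ext_col l) /\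
  le_col (ext_col u) (ext_col ub + slack_upper R sigma) <->
  forall i, admissible (sigma i 0)
    (Kaucher (l i 0 - lb i 0) (u i 0 - ub i 0)).
Proof.
rewrite /le_col; split=> [[Hl Hu] i|H].
  move: (Hl i) (Hu i); rewrite !mxE; case: (sigma i 0) => /=;
    by rewrite ?adde0 ?lee_fin ?subr_ge0 ?subr_le0.
by split=> i; move: (H i); rewrite !mxE; case: (sigma i 0) => /=;
  rewrite ?adde0 ?lee_fin ?subr_ge0 ?subr_le0 ?addeNy ?addey
    ?leNye ?leey // => -[].
Qed.

Lemma lower_charact_mul (R : realType) (m n : nat) (A : 'M[kaucher R]_(m, n))
    (QA : 'M[quantifier]_(m, n)) (x : 'cV[R]_n) :
  lower_mx (kmulmx (charact_mx A QA) x) =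
  lower_mx (kmulmx (forall_part A QA) x)
    + upper_mx (kmulmx (exists_part A QA) x).
Proof.
apply/colP => i; rewrite !mxE !lower_ksum upper_ksum -big_split /=.
apply: eq_bigr => j _; rewrite !mxE; case: (QA i j).
  by rewrite kscale0 addr0.
by rewrite kscale0 add0r kscale_dual.
Qed.

Lemma upper_charact_mul (R : realType) (m n : nat) (A : 'M[kaucher R]_(m, n))
    (QA : 'M[quantifier]_(m, n)) (x : 'cV[R]_n) :
  upper_mx (kmulmx (charact_mx A QA) x) =
  upper_mx (kmulmx (forall_part A QA) x)
    + lower_mx (kmulmx (exists_part A QA) x).
Proof.
apply/colP => i; rewrite !mxE !upper_ksum lower_ksum -big_split /=.
apply: eq_bigr => j _; rewrite !mxE; case: (QA i j).
  by rewrite kscale0 addr0.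
by rewrite kscale0 add0r kscale_dual.
Qed.

Lemma lower_charact_rhs (R : realType) (m : nat) (b : 'cV[kaucher R]_m)
    (Qb : 'cV[quantifier]_m) :
  lower_mx (charact_rhs b Qb) =
  upper_mx (forall_part b Qb) + lower_mx (exists_part b Qb).
Proof.
by apply/colP => i; rewrite !mxE; case: (Qb i 0); rewrite /= ?addr0 ?add0r.
Qed.

Lemma upper_charact_rhs (R : realType) (m : nat) (b : 'cV[kaucher R]_m)
    (Qb : 'cV[quantifier]_m) :
  upper_mx (charact_rhs b Qb) =
  lower_mx (forall_part b Qb) + upper_mx (exists_part b Qb).
Proof.
by apply/colP => i; rewrite !mxE; case: (Qb i 0); rewrite /= ?addr0 ?add0r.
Qed.

Theorem theorem3 (R : realType) (m n : nat)
    (A : 'M[kaucher R]_(m, n)) (b : 'cV[kaucher R]_m)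
    (QA : 'M[quantifier]_(m, n)) (Qb : 'cV[quantifier]_m)
    (sigma : 'cV[relation]_m) (Q : seq (param m n))
    (hA : proper_mx A) (hb : proper_mx b)
    (hQ : is_prefix Q)
    (hQsigma : forall_before_exists_on_eq_rows QA Qb sigma Q)
    (x : 'cV[R]_n) :
  let u := slack_lower R sigma in
  let v := slack_upper R sigma in
  let Ac := charact_mx A QA in
  let bc := charact_rhs b Qb in
  let Aall := forall_part A QA in
  let Aex := exists_part A QA in
  let ball := forall_part b Qb in
  let bex := exists_part b Qb in
  (quantified_system A b QA Qb sigma Q x <->
   le_col (ext_col (lower_mx bc) + u) (ext_col (lower_mx (kmulmx Ac x))) /\
   le_col (ext_col (upper_mx (kmulmx Ac x))) (ext_col (upper_mx bc) + v)) /\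
  (le_col (ext_col (lower_mx bc) + u) (ext_col (lower_mx (kmulmx Ac x))) /\
   le_col (ext_col (upper_mx (kmulmx Ac x))) (ext_col (upper_mx bc) + v) <->
   le_col (ext_col (upper_mx ball + lower_mx bex) + u)
     (ext_col (lower_mx (kmulmx Aall x) + upper_mx (kmulmx Aex x))) /\
   le_col (ext_col (upper_mx (kmulmx Aall x) + lower_mx (kmulmx Aex x)))
     (ext_col (lower_mx ball + upper_mx bex) + v)).
Proof.
move=> u v Ac bc Aall Aex ball bex; split; last first.
  by rewrite lower_charact_mul upper_charact_mul lower_charact_rhs
    upper_charact_rhs.
have uQ : uniq Q by rewrite (perm_uniq hQ) enum_uniq.
have allQ p : p \in Q by rewrite (perm_mem hQ) mem_enum.
have oQ : ordered_on_eq_rows QA Qb sigma Q.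
  by move=> p q _ _ epq sp; apply: (hQsigma (param_row p)).
rewrite /quantified_system quantify_admissible // charact_inequalities_admissible.
by split=> H i; have := H i; rewrite (row_enclosure_full _ _ _ _ _ _ _ _ allQ).
Qed.
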